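(* Let $\kappa$ be an infinite cardinal and let $d>0$ and $m$ be natural numbers. Then \[ w\chi_{\rm CF}(\kappa^{+m},\kappa,d)\le \left\lfloor \frac{(m+1)(d-1)+1}{2}\right\rfloor+1 . \]
   Context: For a family $\mathcal A$ of sets and a cardinal $\rho$, a function $f$ with $\operatorname{dom}(f)\subseteq\bigcup\mathcal A$ and values in $\rho$ is a weak conflict free coloring of $\mathcal A$ if for every $A\in\mathcal A$ there is $\zeta<\rho$ with $|A\cap f^{-1}\{\zeta\}|=1$; $w\chi_{\rm CF}(\mathcal A)$ is the least $\rho$ admitting such a coloring. A family is $\mu$-almost disjoint if distinct members meet in fewer than $\mu$ points. A $(\lambda,\kappa,\mu)$-system is a $\mu$-almost disjoint family of $\lambda$ sets each of size $\kappa$ (members have at least two elements). For $\lambda\ge\kappa\ge\mu$, $\lambda$ infinite, $w\chi_{\rm CF}(\lambda,\kappa,\mu)=\sup\{w\chi_{\rm CF}(\mathcal A):\mathcal A$ a $(\lambda,\kappa,\mu)$-system$\}$. $\kappa^{+m}$ is the $m$-th successor cardinal of $\kappa$. *)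

(* Defs.v *)
(* Cardinals are represented by types: a cardinal is the
   cardinality of a type, compared via injections/bijections. *)
From Stdlib Require Import Arith Classical.

Definition card_le (X Y : Type) : Prop := exists f : X -> Y, forall a b, f a = f b -> a = b.

Definition card_eq (X Y : Type) : Prop :=
  exists f : X -> Y, (forall a b, f a = f b -> a = b) /\ (forall y, exists x, f x = y).

Definition infinite_type (X : Type) : Prop := card_le nat X.

Definition is_succ_card (X Y : Type) : Prop :=
  card_le X Y /\ ~ card_le Y X /\
  (forall Z : Type, card_le Z Y -> card_le Z X \/ card_le Y Z).

Fixpoint nth_succ_card (m : nat) (X Y : Type) : Prop :=
  match m with
  | 0 => card_eq X Y
  | S m' => exists Z : Type, nth_succ_card m' X Z /\ is_succ_card Z Y
  end.

Definition elems {T : Type} (S : T -> Prop) : Type := {x : T | S x}.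

Definition fewer_than {T : Type} (d : nat) (S : T -> Prop) : Prop :=
  ~ card_le {k : nat | k < d} (elems S).

Definition is_system (L K : Type) (d : nat) {T I : Type} (A : I -> T -> Prop) : Prop :=
  card_eq I L /\
  (forall i j, A i = A j -> i = j) /\
  (forall i, card_eq (elems (A i)) K) /\
  (forall i, card_le bool (elems (A i))) /\
  (forall i j, i <> j -> fewer_than d (fun x => A i x /\ A j x)).

(* f is a weak conflict free colouring of the family A with colours
   {0,...,rho-1}: f is a partial function (None = undefined) with domain
   contained in the union of the family, and every member contains a colour
   class of exactly one point. *)
Definition wcf_coloring {T I : Type} (A : I -> T -> Prop) (rho : nat)
    (f : T -> option nat) : Prop :=
  (forall x c, f x = Some c -> c < rho) /\
  (forall x c, f x = Some c -> exists i, A i x) /\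
  (forall i, exists z, z < rho /\ exists! x, A i x /\ f x = Some z).

Definition cf_bound (m d : nat) : nat := ((m + 1) * (d - 1) + 1) / 2 + 1.

(* Main.v *)
(* Write e = d - 1 and let c be the number of colours.  By induction on m, a colouring of
   a set of points meeting every member of the family in at most b points extends to a
   colouring of further points that is weakly conflict free, provided that
   b + (m + 1) * e + 1 < 2 * c: a set with fewer than 2 * c coloured points has a colour
   used at most once on it, and a colour not used at all can be given to one new point.
   Since e + 1 points lie in at most one member of the family, the family is an
   increasing union of smaller subfamilies closed under "having e + 1 points in the
   union"; a set entering at some stage has at most e points covered before, so every
   successor step costs e.  At the bottom level the sets are treated one by one, and a
   set never receives more than e + 1 points before its turn. *)
Require Import Defs.
From Stdlib Require Import Arith Lia List FinFun Classical Wellfounded.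
From Stdlib Require Import Lexicographic_Product Relation_Operators.
From mathcomp Require boolp wochoice.

(** * Well-orders and cardinal comparison *)

Definition strict_wo {X : Type} (R : X -> X -> Prop) : Prop :=
  well_founded R /\ (forall x y z, R x y -> R y z -> R x z) /\
  (forall x y, x = y \/ R x y \/ R y x).

Definition seg {X : Type} (R : X -> X -> Prop) (a : X) : Type := elems (fun x => R x a).

Lemma wf_min {X : Type} {R : X -> X -> Prop} (HR : well_founded R) (P : X -> Prop) :
  (exists x, P x) -> exists x, P x /\ forall y, R y x -> ~ P y.
Proof.
  intros [x Hx]. revert Hx. induction (HR x) as [x _ IH]. intros Hx.
  destruct (classic (exists y, R y x /\ P y)) as [[y [Hy Py]] | N].
  - exact (IH y Hy Py).
  - exists x. split; [exact Hx|]. intros y Hy Py. apply N. now exists y.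
Qed.

Lemma wo_irrefl {X : Type} {R : X -> X -> Prop} (HR : strict_wo R) (x : X) : ~ R x x.
Proof.
  destruct HR as [W _]. induction (W x) as [x _ IH]. intros H. exact (IH x H H).
Qed.

Lemma strict_wo_exists (X : Type) : exists R : X -> X -> Prop, strict_wo R.
Proof.
  destruct (@wochoice.well_ordering_principle
    (boolp.boolp_classicType__canonical__eqtype_Equality X)) as [L HL].
  change (ssrbool.rel X) in L.
  (* [M] carries the minimum principle over from boolean to arbitrary predicates. Sets of one, two
     and three elements then yield reflexivity, antisymmetry and totality, and transitivity. *)
  assert (M : forall P : X -> Prop, (exists x, P x) ->
    exists z, P z /\ (forall x, P x -> L z x = true) /\
      forall z', P z' -> (forall x, P x -> L z' x = true) -> z = z').
  { intros P [x Px].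
    destruct (HL (fun y => boolp.asbool (P y))) as [z [[Hz1 Hz2] Hz3]].
    { exists x. exact (boolp.asboolT Px). }
    exists z. split; [exact (boolp.asboolW Hz1)|]. split.
    - intros y Py. exact (Hz2 y (boolp.asboolT Py)).
    - intros z' Pz' Hz'. apply Hz3. split; [exact (boolp.asboolT Pz')|].
      intros y Py. exact (Hz' y (boolp.asboolW Py)). }
  assert (refl : forall x, L x x = true).
  { intros x. destruct (M (fun y => y = x)) as [z [-> [H _]]]; [now exists x|]. now apply H. }
  assert (anti : forall x y, L x y = true -> L y x = true -> x = y).
  { intros x y Hxy Hyx.
    destruct (M (fun z => z = x \/ z = y)) as [z [_ [_ H]]]; [exists x; now left|].
    rewrite <- (H x), <- (H y); auto; intros t [-> | ->]; auto. }
  exists (fun x y => L x y = true /\ x <> y). split; [|split].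
  - intros x. apply NNPP. intros N.
    destruct (M (fun x => ~ Acc (fun x y => L x y = true /\ x <> y) x)) as [z [Hz [H _]]];
      [now exists x|].
    apply Hz. constructor. intros y [Hy Ny]. apply NNPP. intros Ay.
    apply Ny. apply anti; auto.
  - intros x y z [Hxy Nxy] [Hyz Nyz].
    destruct (M (fun t => t = x \/ t = y \/ t = z)) as [t [Ht [H _]]]; [exists x; now left|].
    assert (t = x) as ->.
    { destruct Ht as [-> | [-> | ->]]; auto.
      - exfalso. apply Nxy. apply anti; auto.
      - exfalso. apply Nyz. apply anti; auto. }
    split; [apply H; auto|]. intros ->. apply Nxy. now apply anti.
  - intros x y. destruct (classic (x = y)) as [E | N]; [now left|right].
    destruct (M (fun z => z = x \/ z = y)) as [z [[-> | ->] [H _]]]; [exists x; now left| |].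
    + left. split; auto.
    + right. split; auto.
Qed.

Lemma nat_strict_wo : strict_wo lt.
Proof. split; [exact lt_wf|split]; intros; lia. Qed.

Lemma strict_wo_pullback {X Y : Type} {R : Y -> Y -> Prop} (f : X -> Y) :
  (forall a b, f a = f b -> a = b) -> strict_wo R -> strict_wo (fun a b => R (f a) (f b)).
Proof.
  intros Hf [W [Tr To]]. split; [|split].
  - now apply wf_inverse_image.
  - intros x y z. apply Tr.
  - intros x y. destruct (To (f x) (f y)) as [E | H]; auto.
Qed.

(* Transfinite recursion: [Q x h b] constrains the value [b] at [x], where [h] is
   known to agree with the function being defined only below [x]. *)
Lemma wf_choice {X B : Type} {R : X -> X -> Prop} (Q : X -> (X -> B) -> B -> Prop) (b0 : B) :
  well_founded R -> (forall x h, exists b, Q x h b) ->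
  exists g : X -> B, forall x, exists h, (forall y, R y x -> h y = g y) /\ Q x h (g x).
Proof.
  intros W HQ.
  destruct (boolp.choice (fun p : X * (X -> B) => HQ (fst p) (snd p))) as [phi Hphi].
  (* A history is known only below [x]; the default [b0] fills it up to the total function that
     [phi] expects. *)
  set (ext := fun x (r : forall y, R y x -> B) y =>
    match boolp.pselect (R y x) with left H => r y H | right _ => b0 end).
  set (F := fun x (r : forall y, R y x -> B) => phi (x, ext x r)).
  exists (Fix W (fun _ => B) F). intros x.
  exists (ext x (fun y _ => Fix W (fun _ => B) F y)). split.
  - intros y H. unfold ext. destruct (boolp.pselect (R y x)); tauto.
  - rewrite Fix_eq.
    + apply (Hphi (x, ext x (fun y _ => Fix W (fun _ => B) F y))).
    + intros y r s E. unfold F. do 2 f_equal. apply boolp.funext. intros z. unfold ext.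
      destruct (boolp.pselect (R z y)); auto.
Qed.

Lemma elems_eq {T : Type} {S : T -> Prop} (a b : elems S) : proj1_sig a = proj1_sig b -> a = b.
Proof. apply eq_sig_hprop. intros. apply proof_irrelevance. Qed.

Lemma card_le_refl (X : Type) : card_le X X.
Proof. now exists (fun x => x). Qed.

Lemma card_le_trans (X Y Z : Type) : card_le X Y -> card_le Y Z -> card_le X Z.
Proof. intros [f Hf] [g Hg]. exists (fun x => g (f x)). auto. Qed.

(** Choice turns the relation into an injection. This spares defining maps into subset types by case
    analysis. *)
Lemma card_le_rel {X Y : Type} (r : X -> Y -> Prop) :
  (forall x, exists y, r x y) -> (forall x x' y, r x y -> r x' y -> x = x') -> card_le X Y.
Proof.
  intros H1 H2. destruct (boolp.choice H1) as [f Hf]. exists f. intros a b E.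
  apply (H2 a b (f a)); [|rewrite E]; apply Hf.
Qed.

Lemma card_eq_le (X Y : Type) : card_eq X Y -> card_le X Y.
Proof. intros [f [Hf _]]. now exists f. Qed.

Lemma card_eq_ge (X Y : Type) : card_eq X Y -> card_le Y X.
Proof.
  intros [f [_ Hf]]. apply (card_le_rel (fun y x => f x = y)); auto. congruence.
Qed.

Lemma card_le_sub {T : Type} (S S' : T -> Prop) :
  (forall x, S x -> S' x) -> card_le (elems S) (elems S').
Proof.
  intros H. exists (fun a => exist S' (proj1_sig a) (H _ (proj2_sig a))).
  intros a b E. apply elems_eq. now injection E.
Qed.

Lemma card_le_elems {T : Type} (S : T -> Prop) : card_le (elems S) T.
Proof. exists (@proj1_sig _ _). intros a b. apply elems_eq. Qed.

Lemma card_le_prod (X X' Y Y' : Type) :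
  card_le X X' -> card_le Y Y' -> card_le (X * Y) (X' * Y').
Proof.
  intros [f Hf] [g Hg]. exists (fun p => (f (fst p), g (snd p))).
  intros [a b] [a' b'] E. injection E; intros E1 E2. f_equal; auto.
Qed.

Lemma card_le_list (X Y : Type) : card_le X Y -> card_le (list X) (list Y).
Proof.
  intros [f Hf]. exists (map f). induction a as [|x l IH];
    intros [|y l'] E; try discriminate; auto.
  injection E; intros E1 E2. f_equal; auto.
Qed.

(** Recursion along [R] sends each [x] to a value not taken before, as long as one is left. If the
    values run out at some [x], choosing preimages injects [Y] into the segment below [x]; otherwise
    the map is injective. *)
Lemma card_le_or_seg (X Y : Type) (R : X -> X -> Prop) :
  strict_wo R -> card_le X Y \/ exists x, card_le Y (seg R x).
Proof.
  intros HR.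
  destruct (classic (inhabited Y)) as [[y0] | NY].
  2:{ destruct (classic (inhabited X)) as [[x] | NX].
      - right. exists x. apply (card_le_rel (fun _ _ => True)); intros y; exfalso; now apply NY.
      - left. apply (card_le_rel (fun _ _ => True)); intros y; exfalso; now apply NX. }
  destruct (@wf_choice X Y R (fun x g b => (exists y, forall x', R x' x -> g x' <> y) ->
    forall x', R x' x -> g x' <> b) y0) as [g Hg].
  { apply HR. }
  { intros x h. destruct (classic (exists y, forall x', R x' x -> h x' <> y)) as [[y Hy] | N].
    - now exists y.
    - exists y0. tauto. }
  destruct (classic (exists x, forall y, exists x', R x' x /\ g x' = y)) as [[x Hx] | N].
  - right. exists x.
    apply (card_le_rel (fun y (s : seg R x) => g (proj1_sig s) = y)).
    + intros y. destruct (Hx y) as [x' [H E]]. now exists (exist _ x' H).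
    + congruence.
  - left. exists g.
    assert (D : forall x' x, R x' x -> g x' <> g x).
    { intros x' x H. destruct (Hg x) as [h [Hh Q]]. rewrite <- (Hh x' H). apply Q; auto.
      apply NNPP. intros N'. apply N. exists x. intros y. apply NNPP. intros Ny. apply N'.
      exists y. intros x'' Hx'' E. apply Ny. exists x''. rewrite <- (Hh _ Hx''). auto. }
    intros a b E. destruct HR as [_ [_ To]]. destruct (To a b) as [? | [H | H]]; auto;
      exfalso; apply (D _ _ H); auto.
Qed.

Lemma card_le_total (X Y : Type) : card_le X Y \/ card_le Y X.
Proof.
  destruct (strict_wo_exists X) as [R HR].
  destruct (card_le_or_seg X Y R HR) as [H | [x H]]; auto.
  right. eapply card_le_trans; [exact H|]. apply card_le_elems.
Qed.

(** Take the least [a] whose segment still receives an injection from [X], and pull the order back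
    along it. A segment of the new order lies inside a segment below some element smaller than [a],
    so it is too small for [X]. *)
Lemma initial_order (X : Type) :
  exists R : X -> X -> Prop, strict_wo R /\ forall x, ~ card_le X (seg R x).
Proof.
  destruct (strict_wo_exists X) as [R HR].
  destruct (classic (exists x, card_le X (seg R x))) as [E | N].
  2:{ exists R. split; auto. intros x H. apply N. now exists x. }
  destruct (wf_min (proj1 HR) _ E) as [a [[f Hf] Ha]].
  assert (Inj : forall x y, proj1_sig (f x) = proj1_sig (f y) -> x = y).
  { intros x y H. apply Hf. now apply elems_eq. }
  exists (fun x y => R (proj1_sig (f x)) (proj1_sig (f y))). split.
  - now apply (strict_wo_pullback (fun x => proj1_sig (f x))).
  - intros x H. apply (Ha _ (proj2_sig (f x))). eapply card_le_trans; [exact H|].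
    exists (fun s => exist (fun z => R z (proj1_sig (f x)))
      (proj1_sig (f (proj1_sig s))) (proj2_sig s)).
    intros s t Est. apply elems_eq. apply Inj. now injection Est.
Qed.

(** * Finite and infinite types *)

Lemma finite_or_infinite (X : Type) :
  infinite_type X \/ exists n, card_le X {k | k < n}.
Proof.
  destruct (card_le_or_seg nat X lt nat_strict_wo) as [H | [n H]]; auto.
  right. now exists n.
Qed.

Lemma infinite_not_finite (X : Type) (n : nat) :
  infinite_type X -> ~ card_le X {k | k < n}.
Proof.
  intros HX HN. destruct (card_le_trans _ _ _ HX HN) as [f Hf].
  assert (H : length (map (fun k => proj1_sig (f k)) (seq 0 (S n))) <= length (seq 0 n)).
  { apply NoDup_incl_length.
    - apply Injective_map_NoDup; [|apply seq_NoDup].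
      intros a b E. apply Hf. now apply (@elems_eq nat (fun k => k < n)).
    - intros x Hx. apply in_map_iff in Hx. destruct Hx as [k [<- _]].
      apply in_seq. destruct (f k) as [j Hj]. simpl. lia. }
  rewrite length_map, !length_seq in H. lia.
Qed.

Lemma card_le_finite_prod (n m : nat) :
  card_le ({k | k < n} * {k | k < m}) {k | k < n * m}.
Proof.
  apply (card_le_rel (fun p q => proj1_sig q = proj1_sig (fst p) * m + proj1_sig (snd p))).
  - intros [[a Ha] [b Hb]]. simpl.
    assert (H : a * m + b < n * m) by nia. now exists (exist (fun k => k < n * m) _ H).
  - intros [[a Ha] [b Hb]] [[a' Ha'] [b' Hb']] q. simpl. intros -> E.
    destruct (Nat.div_mod_unique m a a' b b') as [E1 E2]; auto; [lia|].
    f_equal; now apply (@elems_eq nat (fun k => k < _)).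
Qed.

Lemma card_le_finite_option (n : nat) : card_le (option {k | k < n}) {k | k < S n}.
Proof.
  apply (card_le_rel (fun o q => match o with
    | Some a => proj1_sig q = proj1_sig a
    | None => proj1_sig q = n end)).
  - intros [[a Ha]|]; simpl.
    + assert (H : a < S n) by lia. now exists (exist (fun k => k < S n) _ H).
    + assert (H : n < S n) by lia. now exists (exist (fun k => k < S n) _ H).
  - intros [[a Ha]|] [[a' Ha']|] q; simpl; auto.
    + intros -> E. f_equal. now apply (@elems_eq nat (fun k => k < n)).
    + lia.
    + lia.
Qed.

Lemma card_le_option (X Y : Type) : card_le X Y -> card_le (option X) (option Y).
Proof.
  intros [f Hf]. exists (option_map f). intros [a|] [b|] E; try discriminate; auto.
  injection E; intros. f_equal; auto.
Qed.

(** Hilbert's hotel: a copy of [nat] in [X] is shifted by one and [None] takes the first place. *)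
Lemma infinite_option (X : Type) : infinite_type X -> card_le (option X) X.
Proof.
  intros [g Hg].
  apply (card_le_rel (fun o y => match o with
    | None => y = g 0
    | Some x => (exists n, x = g n /\ y = g (S n)) \/ ((forall n, x <> g n) /\ y = x) end)).
  - intros [x|]; [|now exists (g 0)].
    destruct (classic (exists n, x = g n)) as [[n ->] | N].
    + exists (g (S n)). left. now exists n.
    + exists x. right. split; auto. intros n E. apply N. now exists n.
  - intros [x|] [x'|] y; auto.
    + intros [[n [-> ->]] | [H ->]] [[m [-> E]] | [H' E]]; f_equal; auto.
      * apply Hg in E. injection E; intros ->; auto.
      * exfalso. now apply (H' (S n)).
      * exfalso. now apply (H (S m)).
    + intros [[n [-> ->]] | [H ->]] E; [now apply Hg in E|]. exfalso. now apply (H 0).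
    + intros -> [[n [-> E]] | [H E]]; [now apply Hg in E|]. exfalso. now apply (H 0).
Qed.

(** * Products and lists *)

Lemma strict_wo_lex {X Y : Type} (R : X -> X -> Prop) (S : Y -> Y -> Prop) :
  strict_wo R -> strict_wo S -> strict_wo (slexprod X Y R S).
Proof.
  intros [WR [TR CR]] [WS [TS CS]]. split; [|split].
  - now apply wf_slexprod.
  - intros [a b] [a' b'] [a'' b''] H H'. inversion H; inversion H'; subst;
      try (now apply left_slex; eauto); now apply right_slex; eauto.
  - intros [a b] [a' b']. destruct (CR a a') as [<- | [H | H]].
    + destruct (CS b b') as [<- | [H | H]]; auto; right; [left|right]; now apply right_slex.
    + right; left. now apply left_slex.
    + right; right. now apply left_slex.
Qed.

(* The order is Goedel's: first by the maximum of the two coordinates, so that a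
   proper initial segment is contained in the square of a proper initial segment. *)
Lemma square_of_segments (X : Type) (R : X -> X -> Prop) :
  infinite_type X -> strict_wo R ->
  (forall x, exists Y, card_le (seg R x) Y /\ ~ card_le X Y /\
     (infinite_type Y -> card_le (Y * Y) Y)) ->
  card_le (X * X) X.
Proof.
  intros HX HR HY.
  set (mx := fun p : X * X => if boolp.pselect (R (fst p) (snd p)) then snd p else fst p).
  assert (Hmx : forall p,
    (fst p = mx p \/ R (fst p) (mx p)) /\ (snd p = mx p \/ R (snd p) (mx p))).
  { intros [a b]. unfold mx. simpl. destruct (boolp.pselect (R a b)); auto.
    destruct HR as [_ [_ To]]. destruct (To a b) as [? | [? | ?]]; auto. tauto. }
  set (key := fun p : X * X => (mx p, p)).
  assert (HG : strict_wo (fun p q => slexprod X (X * X) R (slexprod X X R R) (key p) (key q))).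
  { apply (strict_wo_pullback key).
    - intros p q E. now injection E.
    - now repeat apply strict_wo_lex. }
  destruct (card_le_or_seg (X * X) X _ HG) as [H | [p Hp]]; auto. exfalso.
  destruct (HY (mx p)) as [Y [HsY [HXY HYY]]].
  (* If the square does not inject into [X], then [X] injects into the pairs below [p]. Both
     coordinates of such a pair are at most [mx p]; [None] stands for the value [mx p] itself. *)
  assert (HXO : card_le X (option Y * option Y)).
  { eapply card_le_trans; [exact Hp|].
    apply card_le_trans with (option (seg R (mx p)) * option (seg R (mx p)))%type.
    2:{ apply card_le_prod; now apply card_le_option. }
    set (r := fun x (o : option (seg R (mx p))) =>
      match o with Some s => x = proj1_sig s | None => x = mx p end).
    assert (r1 : forall x, x = mx p \/ R x (mx p) -> exists o, r x o).
    { intros x [-> | H]; [now exists None|]. exists (Some (exist _ x H)). reflexivity. }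
    assert (r2 : forall x y o, r x o -> r y o -> x = y).
    { intros x y [o|]; unfold r; congruence. }
    apply (card_le_rel (fun q o => r (fst (proj1_sig q)) (fst o) /\
      r (snd (proj1_sig q)) (snd o))).
    - intros [q Hq]. simpl.
      assert (Hle : mx q = mx p \/ R (mx q) (mx p)).
      { unfold key in Hq. inversion Hq; auto. }
      assert (Hc : forall x, x = mx q \/ R x (mx q) -> x = mx p \/ R x (mx p)).
      { destruct HR as [_ [Tr _]]. intros x [-> | H]; auto. destruct Hle as [<- | H']; eauto. }
      destruct (r1 (fst q)) as [o1 H1]; [apply Hc, Hmx|].
      destruct (r1 (snd q)) as [o2 H2]; [apply Hc, Hmx|].
      now exists (o1, o2).
    - intros [[a b] Hq] [[a' b'] Hq'] o [H1 H2] [H1' H2']. apply elems_eq. simpl in *.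
      f_equal; eauto. }
  destruct (finite_or_infinite Y) as [I | [n Hn]].
  - apply HXY. eapply card_le_trans; [exact HXO|].
    eapply card_le_trans; [|apply HYY, I].
    apply card_le_prod; now apply infinite_option.
  - apply (infinite_not_finite X (S n * S n) HX).
    eapply card_le_trans; [exact HXO|].
    eapply card_le_trans; [|apply card_le_finite_prod].
    assert (H : card_le (option Y) {k | k < S n}).
    { eapply card_le_trans; [apply card_le_option, Hn|]. apply card_le_finite_option. }
    now apply card_le_prod.
Qed.

Lemma infinite_square (X : Type) : infinite_type X -> card_le (X * X) X.
Proof.
  intros HX. destruct (initial_order X) as [R [HR Hs]].
  assert (P : forall a, infinite_type (seg R a) -> card_le (seg R a * seg R a) (seg R a)).
  { intros a. induction (proj1 HR a) as [a _ IH]. intros Ha.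
    (* Either the segment is equinumerous with a shorter one and inherits its pairing, or all its
       proper segments are strictly smaller and Goedel's order applies to it. *)
    destruct (classic (exists b, R b a /\ card_le (seg R a) (seg R b))) as [[b [Hb Hab]] | N].
    - assert (Hba : card_le (seg R b) (seg R a)).
      { apply card_le_sub. intros x Hx. destruct HR as [_ [Tr _]]. now apply Tr with b. }
      eapply card_le_trans; [apply card_le_prod; exact Hab|].
      eapply card_le_trans; [|exact Hba]. apply IH; auto. now apply card_le_trans with (seg R a).
    - apply (square_of_segments (seg R a) (fun s t => R (proj1_sig s) (proj1_sig t))); auto.
      + apply (strict_wo_pullback (fun s : seg R a => proj1_sig s)); auto.
        intros s t. apply elems_eq.
      + intros [s Hsa]. exists (seg R s). split; [|split].
        * exists (fun t => exist (fun x => R x s) (proj1_sig (proj1_sig t)) (proj2_sig t)).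
          intros t u E. do 2 apply elems_eq. now injection E.
        * intros H. apply N. now exists s.
        * apply IH; auto. }
  apply (square_of_segments X R); auto. intros x. exists (seg R x).
  split; [apply card_le_refl|]. auto.
Qed.

(** If the larger factor is infinite, it absorbs the product; if it is finite, so is the product. *)
Lemma prod_not_ge (K X Y : Type) : infinite_type K ->
  ~ card_le K X -> ~ card_le K Y -> ~ card_le K (X * Y).
Proof.
  intros HK.
  assert (H : forall X Y, card_le X Y -> ~ card_le K Y -> ~ card_le K (X * Y)).
  { clear X Y. intros X Y HXY HY H.
    destruct (finite_or_infinite Y) as [I | [n Hn]].
    - apply HY. eapply card_le_trans; [exact H|].
      eapply card_le_trans; [|apply infinite_square, I].
      apply card_le_prod; auto. apply card_le_refl.
    - apply (infinite_not_finite K (n * n) HK).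
      eapply card_le_trans; [exact H|]. eapply card_le_trans; [|apply card_le_finite_prod].
      apply card_le_prod; auto. now apply card_le_trans with Y. }
  intros HX HY. destruct (card_le_total X Y) as [L | L]; [now apply H|].
  intros HXY. apply (H Y X L HX). eapply card_le_trans; [exact HXY|].
  exists (fun p => (snd p, fst p)). intros [a b] [a' b'] E. simpl in E. congruence.
Qed.

Lemma card_le_Union {J T Z : Type} (F : J -> T -> Prop) :
  (forall j, card_le (elems (F j)) Z) ->
  card_le (elems (fun x => exists j, F j x)) (J * Z).
Proof.
  intros H. set (f := fun j => proj1_sig (boolp.cid (H j))).
  assert (Hf : forall j a b, f j a = f j b -> a = b)
    by (intros j; exact (proj2_sig (boolp.cid (H j)))).
  apply (card_le_rel (fun x p => exists y : elems (F (fst p)),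
    proj1_sig y = proj1_sig x /\ f (fst p) y = snd p)).
  - intros [x [j Hj]]. exists (j, f j (exist _ x Hj)). now exists (exist (F j) x Hj).
  - intros x x' [j z] [y [E1 E2]] [y' [E1' E2']]. apply elems_eq. rewrite <- E1, <- E1'.
    f_equal. apply (Hf j). simpl in *. congruence.
Qed.

Lemma card_le_or_bool {T Z : Type} (S S' : T -> Prop) :
  card_le (elems S) Z -> card_le (elems S') Z ->
  card_le (elems (fun x => S x \/ S' x)) (bool * Z).
Proof.
  intros H H'.
  eapply card_le_trans; [|apply (card_le_Union (fun b : bool => if b then S else S'))].
  - apply card_le_sub. intros x [Hx | Hx]; [now exists true|now exists false].
  - now intros [|].
Qed.

Lemma infinite_prod_nat (Z : Type) : infinite_type Z -> card_le (nat * Z) Z.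
Proof.
  intros HZ. eapply card_le_trans; [|apply infinite_square, HZ].
  apply card_le_prod; [exact HZ|apply card_le_refl].
Qed.

Lemma card_le_bool_finite : card_le bool {k | k < 2}.
Proof.
  assert (H0 : 0 < 2) by lia. assert (H1 : 1 < 2) by lia.
  exists (fun b : bool => if b then exist (fun k => k < 2) 0 H0 else exist (fun k => k < 2) 1 H1).
  now intros [|] [|].
Qed.

Lemma card_le_or {T Z : Type} (S S' : T -> Prop) : infinite_type Z ->
  card_le (elems S) Z -> card_le (elems S') Z -> card_le (elems (fun x => S x \/ S' x)) Z.
Proof.
  intros HZ H H'. eapply card_le_trans; [|apply infinite_prod_nat, HZ].
  eapply card_le_trans; [apply (card_le_or_bool S S' H H')|].
  apply card_le_prod; [|apply card_le_refl].
  eapply card_le_trans; [apply card_le_bool_finite|]. apply card_le_elems.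
Qed.

Lemma or_not_ge {K T : Type} (S S' : T -> Prop) : infinite_type K ->
  ~ card_le K (elems S) -> ~ card_le K (elems S') ->
  ~ card_le K (elems (fun x => S x \/ S' x)).
Proof.
  intros HK HS HS' H.
  assert (B : ~ card_le K bool).
  { intros HB. apply (infinite_not_finite K 2 HK).
    eapply card_le_trans; [exact HB|]. apply card_le_bool_finite. }
  destruct (card_le_total (elems S) (elems S')) as [L | L].
  - apply (prod_not_ge K bool _ HK B HS'). eapply card_le_trans; [exact H|].
    apply card_le_or_bool; auto. apply card_le_refl.
  - apply (prod_not_ge K bool _ HK B HS). eapply card_le_trans; [exact H|].
    apply card_le_or_bool; auto. apply card_le_refl.
Qed.

Lemma infinite_list (Z : Type) : infinite_type Z -> card_le (list Z) Z.
Proof.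
  intros HZ. destruct (infinite_square Z HZ) as [g Hg].
  assert (z0 : Z) by (destruct (boolp.cid HZ) as [h _]; exact (h 0)).
  set (enc := fix enc l := match l with nil => z0 | x :: l => g (x, enc l) end).
  eapply card_le_trans; [|apply infinite_prod_nat, HZ].
  (* The length is recorded because [z0], the code of [nil], may also be the code of a nonempty
     list. *)
  exists (fun l => (length l, enc l)).
  induction a as [|x l IH]; intros [|y l'] E; try discriminate; auto.
  injection E; intros E1 E2. apply Hg in E1. injection E1; intros E3 ->.
  f_equal. apply IH. now f_equal.
Qed.

Lemma lists_not_ge (K X : Type) (n : nat) : infinite_type K -> ~ card_le K X ->
  ~ card_le K {l : list X | length l = n}.
Proof.
  intros HK HX. induction n as [|n IH].
  - intros H. apply (infinite_not_finite K 1 HK). eapply card_le_trans; [exact H|].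
    apply (card_le_rel (fun _ _ => True)).
    + intros _. assert (H0 : 0 < 1) by lia. now exists (exist (fun k => k < 1) 0 H0).
    + intros [[|] ?] [[|] ?] _ _ _; try discriminate.
      now apply (@elems_eq _ (fun l : list X => length l = 0)).
  - intros H. apply (prod_not_ge K X _ HK HX IH). eapply card_le_trans; [exact H|].
    apply (card_le_rel (fun l p => proj1_sig l = fst p :: proj1_sig (snd p))).
    + intros [[|x l] E]; try discriminate. injection E; intros E'. now exists (x, exist _ l E').
    + intros l l' p E E'. apply (@elems_eq _ (fun l : list X => length l = S n)). congruence.
Qed.

(** * Finite bounds *)

(** The bound is witnessed by a covering list, possibly with repetitions and extra entries, so it
    passes to subsets and unions without counting. *)
Definition at_most {T : Type} (n : nat) (S : T -> Prop) : Prop :=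
  exists l, length l <= n /\ forall x, S x -> In x l.

Lemma at_most_sub {T : Type} (n : nat) (S S' : T -> Prop) :
  at_most n S' -> (forall x, S x -> S' x) -> at_most n S.
Proof. intros [l [H1 H2]] H. exists l. auto. Qed.

Lemma at_most_or {T : Type} (n n' : nat) (S S' : T -> Prop) :
  at_most n S -> at_most n' S' -> at_most (n + n') (fun x => S x \/ S' x).
Proof.
  intros [l [H1 H2]] [l' [H1' H2']]. exists (l ++ l'). split.
  - rewrite length_app. lia.
  - intros x [H | H]; apply in_or_app; auto.
Qed.

Lemma at_most_length {T : Type} (n : nat) (S : T -> Prop) (l : list T) :
  at_most n S -> NoDup l -> (forall x, In x l -> S x) -> length l <= n.
Proof.
  intros [l' [H1 H2]] Hl Hs. apply Nat.le_trans with (length l'); auto.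
  apply NoDup_incl_length; auto. intros x Hx. auto.
Qed.

Lemma not_at_most {T : Type} (n : nat) (S : T -> Prop) :
  ~ at_most n S -> exists l, NoDup l /\ length l = n + 1 /\ forall x, In x l -> S x.
Proof.
  assert (H : forall l, length l <= n -> ~ at_most n S -> exists x, S x /\ ~ In x l).
  { intros l Hl HS. apply NNPP. intros N. apply HS. exists l. split; auto.
    intros x Hx. apply NNPP. intros N'. apply N. now exists x. }
  intros HS.
  assert (H' : forall k, k <= n ->
    exists l, NoDup l /\ length l = k + 1 /\ forall x, In x l -> S x).
  { induction k as [|k IH]; intros Hk.
    - destruct (H nil) as [x [Hx _]]; [simpl; lia|exact HS|].
      exists (x :: nil). split; [|split]; auto.
      + constructor; auto. constructor.
      + now intros y [<- | []].
    - destruct IH as [l [H1 [H2 H3]]]; [lia|].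
      destruct (H l) as [x [Hx Hn]]; auto; [lia|].
      exists (x :: l). split; [|split].
      + now constructor.
      + simpl. lia.
      + intros y [<- | Hy]; auto. }
  now apply H'.
Qed.

Lemma at_most_card_le {T : Type} (n : nat) (S : T -> Prop) :
  at_most n S -> card_le (elems S) {k | k < n}.
Proof.
  intros [l [H1 H2]].
  apply (card_le_rel (fun x k => nth_error l (proj1_sig k) = Some (proj1_sig x))).
  - intros [x Hx]. destruct (In_nth_error l x (H2 x Hx)) as [k Hk].
    assert (Hlt : k < n).
    { apply Nat.lt_le_trans with (length l); auto. apply nth_error_Some. congruence. }
    now exists (exist (fun k => k < n) k Hlt).
  - intros x x' k E E'. apply elems_eq. rewrite E in E'. now injection E'.
Qed.

Lemma fewer_than_at_most {T : Type} (d : nat) (S : T -> Prop) :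
  0 < d -> fewer_than d S -> at_most (d - 1) S.
Proof.
  intros Hd HS. apply NNPP. intros N. apply HS.
  destruct (not_at_most _ _ N) as [l [H1 [H2 H3]]].
  apply (card_le_rel (fun k x => nth_error l (proj1_sig k) = Some (proj1_sig x))).
  - intros [k Hk]. simpl. destruct (nth_error l k) as [x|] eqn:E.
    + now exists (exist S x (H3 x (nth_error_In _ _ E))).
    + apply nth_error_None in E. lia.
  - intros [k Hk] [k' Hk'] x E E'. apply (@elems_eq nat (fun k => k < d)). simpl in *.
    apply (proj1 (NoDup_nth_error l) H1 k k'); [lia|congruence].
Qed.

Lemma at_most_elems {T : Type} (n : nat) (S U : T -> Prop) :
  at_most n (fun u : elems U => S (proj1_sig u)) -> at_most n (fun x => S x /\ U x).
Proof.
  intros [l [H1 H2]]. exists (map (@proj1_sig _ _) l). split.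
  - now rewrite length_map.
  - intros x [Hx Ux]. apply in_map_iff. exists (exist U x Ux). split; auto.
Qed.

(** [F] need not be functional, since a point may lie in sets of several ranks or stages; for each
    entry just one of its values is compared. *)
Lemma list_greatest {A B : Type} (R : B -> B -> Prop) (F : A -> B -> Prop) (l : list A) :
  strict_wo R -> l <> nil -> (forall x, In x l -> exists b, F x b) ->
  exists x b, In x l /\ F x b /\
    forall y, In y l -> exists b', F y b' /\ (b' = b \/ R b' b).
Proof.
  intros [_ [Tr To]]. induction l as [|x [|y l] IH]; intros N H; [tauto| |].
  - destruct (H x) as [b Hb]; [now left|]. exists x, b. split; [now left|split; auto].
    intros y [<- | []]. exists b. auto.
  - destruct (H x) as [b Hb]; [now left|].
    destruct IH as [x' [b' [H1 [H2 H3]]]]; [discriminate|intros; apply H; now right|].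
    assert (C : (b = b' \/ R b b') \/ R b' b) by (destruct (To b b') as [? | [? | ?]]; auto).
    destruct C as [C | C].
    + exists x', b'. split; [now right|split; auto].
      intros z [<- | Hz]; [now exists b|auto].
    + exists x, b. split; [now left|split; auto].
      intros z [<- | Hz]; [exists b; auto|].
      destruct (H3 z Hz) as [b'' [F1 F2]]. exists b''. split; auto. right.
      destruct F2 as [-> | F2]; eauto.
Qed.

Lemma color_at_most_once {T : Type} (n c : nat) (S : T -> Prop) (col : T -> nat -> Prop) :
  n < 2 * c -> (forall x z z', col x z -> col x z' -> z = z') ->
  at_most n (fun x => S x /\ exists z, col x z) ->
  exists z, z < c /\ forall x y, S x -> col x z -> S y -> col y z -> x = y.
Proof.
  intros Hn Hf Hm. apply NNPP. intros N.
  (* Pigeonhole: if every colour below [c] is repeated on [S], two points per colour give [2 * c]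
     distinct coloured points. *)
  assert (H : forall k, k <= c -> exists l, NoDup l /\ length l = 2 * k /\
    forall x, In x l -> S x /\ exists z, z < k /\ col x z).
  { induction k as [|k IH]; intros Hk.
    - exists nil. split; [constructor|split; auto]. intros x [].
    - destruct IH as [l [H1 [H2 H3]]]; [lia|].
      assert (E : exists x y, x <> y /\ S x /\ col x k /\ S y /\ col y k).
      { apply NNPP. intros N'. apply N. exists k. split; [lia|]. intros x y Sx Cx Sy Cy.
        apply NNPP. intros Hxy. apply N'. now exists x, y. }
      destruct E as [x [y [Hxy [Sx [Cx [Sy Cy]]]]]].
      assert (Nl : forall t, col t k -> ~ In t l).
      { intros t Ct Ht. destruct (H3 t Ht) as [_ [z [Hz Cz]]].
        rewrite (Hf t z k Cz Ct) in Hz. lia. }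
      exists (x :: y :: l). split; [|split].
      + constructor; [|constructor; auto].
        intros [E | E]; [now apply Hxy|]. now apply (Nl x).
      + simpl. lia.
      + intros t [<- | [<- | Ht]].
        * split; auto. exists k. split; auto.
        * split; auto. exists k. split; auto.
        * destruct (H3 t Ht) as [St [z [Hz Cz]]]. split; auto. exists z. split; auto. }
  destruct (H c) as [l [H1 [H2 H3]]]; auto.
  assert (Hl : length l <= n).
  { apply (at_most_length n _ l Hm H1). intros x Hx.
    destruct (H3 x Hx) as [Sx [z [_ Cz]]]. split; auto. now exists z. }
  lia.
Qed.

(** * Almost disjoint families and extension of colourings *)

Definition almost_disjoint {T I : Type} (e : nat) (A : I -> T -> Prop) : Prop :=
  forall i j, i <> j -> at_most e (fun x => A i x /\ A j x).

(** A member with more than [e] points in [U] is determined by any [e + 1] distinct ones among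
    them. *)
Lemma card_le_determined {T I : Type} (e : nat) (A : I -> T -> Prop) (U : T -> Prop) :
  almost_disjoint e A ->
  card_le (elems (fun i => ~ at_most e (fun x => A i x /\ U x)))
          {l : list (elems U) | length l = e + 1}.
Proof.
  intros HA.
  apply (card_le_rel (fun i l => NoDup (proj1_sig l) /\
    forall u, In u (proj1_sig l) -> A (proj1_sig i) (proj1_sig u))).
  - intros [i Hi].
    destruct (not_at_most e (fun u : elems U => A i (proj1_sig u))) as [l [H1 [H2 H3]]].
    { intros H. apply Hi. now apply at_most_elems. }
    now exists (exist (fun l : list (elems U) => length l = e + 1) l H2).
  - intros i j [l Hl] [H1 H2] [_ H3]. simpl in *. apply elems_eq. apply NNPP. intros N.
    assert (H : length (map (@proj1_sig _ _) l) <= e).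
    { apply (at_most_length e _ _ (HA _ _ N)).
      - apply Injective_map_NoDup; auto. intros u v. apply elems_eq.
      - intros x Hx. apply in_map_iff in Hx. destruct Hx as [u [<- Hu]]. auto. }
    rewrite length_map in H. apply (Nat.nle_succ_diag_l e).
    rewrite <- Nat.add_1_r, <- Hl. exact H.
Qed.

(* [P] is the set of points already decided on by [f0], coloured or not. *)
Definition extendable {T I : Type} (c b : nat) (A : I -> T -> Prop) : Prop :=
  forall (P : T -> Prop) (f0 : T -> option nat),
    (forall i, at_most b (fun x => A i x /\ P x)) ->
    exists f : T -> option nat,
      (forall x, P x -> f x = f0 x) /\
      (forall x z, ~ P x -> f x = Some z -> z < c /\ exists i, A i x) /\
      (forall i, exists z, z < c /\ exists! x, A i x /\ f x = Some z).

(** * Families of the least cardinality *)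

(** The forbidden points of [A a] are at most [b] from [P], at most [e] for each earlier index, and
    at most [e] for each other set with more than [e] points in [U]. There are fewer than [K] such
    sets, being determined by lists over [U], so fewer than [K] points are forbidden. *)
Lemma fresh_point {T I : Type} (K : Type) (R : I -> I -> Prop) (A : I -> T -> Prop)
    (b e : nat) (P U : T -> Prop) (a : I) :
  infinite_type K -> almost_disjoint e A ->
  card_le K (elems (A a)) -> ~ card_le K (seg R a) -> ~ card_le K (elems U) ->
  (~ R a a) -> at_most b (fun x => A a x /\ P x) ->
  exists x, A a x /\ ~ P x /\ (forall i, R i a -> ~ A i x) /\
    forall j, j <> a -> ~ at_most e (fun y => A j y /\ U y) -> ~ A j x.
Proof.
  intros HK HA HKa HR HU Ha HP.
  set (Sat := fun j => ~ at_most e (fun y => A j y /\ U y)).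
  set (bad := fun x => (A a x /\ P x) \/
    ((exists i : seg R a, A a x /\ A (proj1_sig i) x) \/
     (exists j : elems (fun j => j <> a /\ Sat j), A a x /\ A (proj1_sig j) x))).
  apply NNPP. intros N.
  assert (HB : forall x, A a x -> bad x).
  { intros x Hx. apply NNPP. intros Nb. apply N. exists x. split; auto. split; [|split].
    - intros Px. apply Nb. now left.
    - intros i Hi Ai. apply Nb. right; left. now exists (exist (fun i => R i a) i Hi).
    - intros j Hj Sj Aj. apply Nb. right; right.
      now exists (exist (fun j => j <> a /\ Sat j) j (conj Hj Sj)). }
  assert (Hfin : forall n, ~ card_le K {k | k < n}) by (intros n; now apply infinite_not_finite).
  apply (or_not_ge (fun x => A a x /\ P x) (fun x =>
    (exists i : seg R a, A a x /\ A (proj1_sig i) x) \/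
    (exists j : elems (fun j => j <> a /\ Sat j), A a x /\ A (proj1_sig j) x)) HK).
  - intros H. apply (Hfin b). eapply card_le_trans; [exact H|]. now apply at_most_card_le.
  - assert (HF : forall J : Type, ~ card_le K J -> forall h : J -> I, (forall j, h j <> a) ->
      ~ card_le K (elems (fun x => exists j, A a x /\ A (h j) x))).
    { intros J HJ h Hh H. apply (prod_not_ge K J {k | k < e} HK HJ (Hfin e)).
      eapply card_le_trans; [exact H|]. apply card_le_Union. intros j. apply at_most_card_le.
      apply HA. intros E. now apply (Hh j). }
    apply or_not_ge; auto.
    + apply HF; auto. intros [i Hi] E. simpl in E. subst. tauto.
    + apply HF.
      * intros H. apply (lists_not_ge K _ (e + 1) HK HU). eapply card_le_trans; [exact H|].
        eapply card_le_trans; [|apply (card_le_determined e A U HA)].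
        apply card_le_sub. intros j [_ Sj]. exact Sj.
      * intros [j [Hj Sj]]. exact Hj.
  - eapply card_le_trans; [exact HKa|]. now apply card_le_sub.
Qed.

(* Recursion along an initial order of the index set.  Stage [i] colours at most one
   new point, which avoids every other set already containing [e + 1] new points; hence
   when its turn comes [A i] has at most [e + 1] new points and at most [b + e + 1 < 2 * c]
   coloured ones, so some colour is used at most once on it. *)
Lemma extendable_base {T I : Type} (K : Type) (c b e : nat) (A : I -> T -> Prop) :
  infinite_type K -> card_le I K -> (forall i, card_le K (elems (A i))) ->
  almost_disjoint e A -> b + e + 1 < 2 * c -> extendable c b A.
Proof.
  intros HK [u Hu] HKA HA Hc P f0 HP.
  destruct (initial_order K) as [RK [HRK HsK]].
  set (R := fun i j => RK (u i) (u j)).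
  assert (HR : strict_wo R) by exact (strict_wo_pullback u Hu HRK).
  assert (Hs : forall i, ~ card_le K (seg R i)).
  { intros i H. apply (HsK (u i)). eapply card_le_trans; [exact H|].
    exists (fun j => exist (fun k => RK k (u i)) (u (proj1_sig j)) (proj2_sig j)).
    intros j j' E. apply elems_eq, Hu. now injection E. }
  (* [used] collects the points added before stage [i]; [col] is the partial colouring visible at
     stage [i], from [f0] on [P] and from earlier stages elsewhere. *)
  set (used := fun (h : I -> option (T * nat)) i x => exists j z, R j i /\ h j = Some (x, z)).
  set (col := fun (h : I -> option (T * nat)) i x z =>
    (P x /\ f0 x = Some z) \/ (~ P x /\ exists j, R j i /\ h j = Some (x, z))).
  (* Three cases: some colour already occurs exactly once on [A i]; a fresh point receives a colour
     [z] absent from [A i]; or the history is faulty. The last one is there because the recursion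
     must answer every [h]; [Hfew] and [Hcol] exclude it for the actual [g]. *)
  set (Q := fun i h o =>
    (o = None /\ exists z, z < c /\ exists! x, A i x /\ col h i x z) \/
    (exists x z, o = Some (x, z) /\ z < c /\ A i x /\ ~ P x /\ (forall j, R j i -> ~ A j x) /\
      (forall j, j <> i -> ~ at_most e (fun y => A j y /\ used h i y) -> ~ A j x) /\
      forall y, A i y -> ~ col h i y z) \/
    (o = None /\ (~ at_most (e + 1) (fun x => A i x /\ used h i x) \/
                  ~ forall x z z', col h i x z -> col h i x z' -> z = z'))).
  destruct (@wf_choice I _ R Q None (proj1 HR)) as [g Hg].
  { intros i h.
    destruct (classic (at_most (e + 1) (fun x => A i x /\ used h i x))) as [H1 | H1].
    2:{ exists None. right; right. auto. }
    destruct (classic (forall x z z', col h i x z -> col h i x z' -> z = z')) as [H2 | H2].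
    2:{ exists None. right; right. auto. }
    destruct (color_at_most_once (b + (e + 1)) c (A i) (col h i)) as [z [Hz Hu1]]; auto; [lia| |].
    { eapply at_most_sub; [apply at_most_or; [apply (HP i)|exact H1]|].
      intros x [Ax [z [[Px _] | [_ [j [Hj E]]]]]]; [now left|right].
      split; auto. now exists j, z. }
    destruct (classic (exists x, A i x /\ col h i x z)) as [[x [Ax Cx]] | N].
    - exists None. left. split; auto. exists z. split; auto. exists x. split; auto.
      intros y [Ay Cy]. auto.
    - destruct (fresh_point K R A b e P (used h i) i) as [x [Ax [Px [X1 X2]]]]; auto.
      + intros H. apply (Hs i). eapply card_le_trans; [exact H|].
        apply (card_le_rel (fun x j => exists z, h (proj1_sig j) = Some (proj1_sig x, z))).
        * intros [x [j [z' [Hj E]]]]. exists (exist (fun j => R j i) j Hj). now exists z'.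
        * intros x x' j [z1 E1] [z2 E2]. apply elems_eq. rewrite E1 in E2. now injection E2.
      + now apply wo_irrefl.
      + exists (Some (x, z)). right; left. exists x, z. repeat (split; auto).
        intros y Ay Cy. apply N. now exists y. }
  (* [Q i] reads its history only below [i], where [h] and [g] agree. *)
  assert (HQ : forall i, Q i g (g i)).
  { intros i. destruct (Hg i) as [h [Hh Hq]].
    assert (Eu : used h i = used g i).
    { apply boolp.funext. intros x. apply boolp.propext. unfold used.
      split; intros [j [z [Hj E]]]; exists j, z; (split; [exact Hj|]);
        [rewrite <- Hh|rewrite Hh]; auto. }
    assert (Ec : col h i = col g i).
    { do 2 (apply boolp.funext; intros ?). apply boolp.propext. unfold col.
      split; (intros [? | [Px [j [Hj E]]]]; [now left|right]); split; auto; exists j;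
        (split; [exact Hj|]); [rewrite <- Hh|rewrite Hh]; auto. }
    unfold Q in *. rewrite <- Eu, <- Ec. exact Hq. }
  assert (Hsome : forall i x z, g i = Some (x, z) -> z < c /\ A i x /\ ~ P x /\
    (forall j, R j i -> ~ A j x) /\
    (forall j, j <> i -> ~ at_most e (fun y => A j y /\ used g i y) -> ~ A j x) /\
    forall y, A i y -> ~ col g i y z).
  { intros i x z E.
    destruct (HQ i) as [[E' _] | [[x' [z' [E' H]]] | [E' _]]]; try congruence.
    rewrite E in E'. injection E'; intros -> ->. exact H. }
  assert (Hinj : forall i j x z z', g i = Some (x, z) -> g j = Some (x, z') -> i = j).
  { assert (D : forall i j x z z', g i = Some (x, z) -> g j = Some (x, z') -> ~ R i j).
    { intros i j x z z' Ei Ej H. destruct (Hsome _ _ _ Ei) as [_ [Ai _]].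
      destruct (Hsome _ _ _ Ej) as [_ [_ [_ [Hj _]]]]. exact (Hj i H Ai). }
    intros i j x z z' Ei Ej. destruct (proj2 (proj2 HR) i j) as [? | [H | H]]; auto; exfalso.
    - exact (D _ _ _ _ _ Ei Ej H).
    - exact (D _ _ _ _ _ Ej Ei H). }
  assert (Hcol : forall i x z z', col g i x z -> col g i x z' -> z = z').
  { intros i x z z' [[Px E] | [Px [j [_ E]]]] [[Px' E'] | [Px' [j' [_ E']]]];
      try tauto; try congruence.
    rewrite (Hinj _ _ _ _ _ E E') in E. congruence. }
  (* Among [e + 2] added points of [A i], consider the one added last. By then [A i] already held
     [e + 1] added points, so that stage had to avoid [A i]. *)
  assert (Hfew : forall i, at_most (e + 1) (fun x => A i x /\ used g i x)).
  { intros i. apply NNPP. intros N. destruct (not_at_most _ _ N) as [l [L1 [L2 L3]]].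
    destruct (list_greatest R (fun x j => R j i /\ exists z, g j = Some (x, z)) l HR)
      as [x [j [Hx [[Hj [z E]] Hmax]]]].
    { intros ->. simpl in L2. lia. }
    { intros x Hx. destruct (L3 x Hx) as [_ [j [z [Hj E]]]].
      exists j. split; auto. now exists z. }
    destruct (Hsome _ _ _ E) as [_ [_ [_ [_ [Hsat _]]]]].
    apply (Hsat i); [intros ->; now apply (wo_irrefl HR j)| |now apply L3].
    intros Hm. destruct (in_split _ _ Hx) as [l1 [l2 ->]].
    destruct (NoDup_remove _ _ _ L1) as [L4 L5].
    assert (H : length (l1 ++ l2) <= e).
    { apply (at_most_length e _ _ Hm L4). intros y Hy.
      assert (Hy' : In y (l1 ++ x :: l2)).
      { apply in_or_app. simpl. apply in_app_or in Hy. tauto. }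
      split; [now apply L3|]. destruct (Hmax y Hy') as [j' [[_ [z' E']] [-> | Hj']]].
      - exfalso. apply L5. rewrite E in E'. injection E'; intros _ ->. exact Hy.
      - now exists j', z'. }
    rewrite length_app in *. simpl in L2. lia. }
  destruct (boolp.choice (P := fun x o => (P x -> o = f0 x) /\
    (~ P x -> forall z, o = Some z <-> exists i, g i = Some (x, z)))) as [f Hf].
  { intros x. destruct (classic (P x)) as [Px | Px]; [now exists (f0 x)|].
    destruct (classic (exists i z, g i = Some (x, z))) as [[i [z E]] | N].
    - exists (Some z). split; [tauto|]. intros _ z'. split.
      + intros E'. injection E'; intros <-. now exists i.
      + intros [j E']. rewrite (Hinj _ _ _ _ _ E E') in E. congruence.
    - exists None. split; [tauto|]. intros _ z. split; [discriminate|].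
      intros [i E]. exfalso. apply N. now exists i, z. }
  (* Stages after [i] never touch points of [A i], so on [A i] the final colouring is what stage [i]
     saw, up to the choice made at stage [i] itself. *)
  assert (Hfcol : forall i x z, A i x -> g i <> Some (x, z) ->
    (f x = Some z <-> col g i x z)).
  { intros i x z Ax Hgi. destruct (Hf x) as [F1 F2]. split.
    - intros E. destruct (classic (P x)) as [Px | Px].
      + left. split; auto. now rewrite <- F1.
      + right. split; auto. apply F2 in E; auto. destruct E as [j E]. exists j. split; auto.
        destruct (Hsome _ _ _ E) as [_ [_ [_ [Hj _]]]].
        destruct (proj2 (proj2 HR) j i) as [-> | [H | H]]; auto; [tauto|].
        exfalso. exact (Hj i H Ax).
    - intros [[Px E] | [Px [j [_ E]]]].
      + now rewrite F1.
      + apply F2; auto. now exists j. }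
  exists f. split; [|split].
  - intros x. apply Hf.
  - intros x z Px E. apply (proj2 (Hf x)) in E; auto. destruct E as [i E].
    destruct (Hsome _ _ _ E) as [H1 [H2 _]]. split; auto. now exists i.
  - intros i.
    destruct (HQ i) as [[E [z [Hz [x [[Ax Cx] Hx]]]]] | [[x [z [E [Hz H]]]] | [_ [H | H]]]].
    + exists z. split; auto. exists x. split.
      * split; auto. apply (Hfcol i); auto. congruence.
      * intros y [Ay Ey]. apply Hx. split; auto. apply (Hfcol i); auto. congruence.
    + destruct H as [Ax [Px [_ [_ Hn]]]]. exists z. split; auto. exists x. split.
      * split; auto. apply (Hf x); auto. now exists i.
      * intros y [Ay Ey]. apply NNPP. intros Nxy. apply (Hn y Ay). apply Hfcol; auto. congruence.
    + exfalso. auto.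
    + exfalso. apply H. apply Hcol.
Qed.

(** * Successor cardinals *)

(** Stage [n] of closing [D] under adding every set with more than [e] points in the union so far.
    The union is indexed by a subtype to fit [card_le_Union]. *)
Fixpoint closure {T I : Type} (e : nat) (A : I -> T -> Prop) (D : I -> Prop)
    (n : nat) : I -> Prop :=
  match n with
  | 0 => D
  | S n => fun i => closure e A D n i \/
             ~ at_most e (fun x => A i x /\ exists j : elems (closure e A D n), A (proj1_sig j) x)
  end.

Lemma closure_le {T I : Type} (e : nat) (A : I -> T -> Prop) (D : I -> Prop) (n m : nat) (i : I) :
  n <= m -> closure e A D n i -> closure e A D m i.
Proof. induction 1; simpl; auto. Qed.

Lemma closure_sub {T I : Type} (e : nat) (A : I -> T -> Prop) (D D' : I -> Prop) (n : nat) :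
  (forall i, D i -> D' i) -> forall i, closure e A D n i -> closure e A D' n i.
Proof.
  intros H. induction n as [|n IH]; simpl; auto. intros i [Hi | Hi]; auto.
  right. intros H'. apply Hi. apply (at_most_sub _ _ _ H').
  intros x [Ax [[j Hj] Aj]]. split; auto. now exists (exist _ j (IH j Hj)).
Qed.

(** A set added at one stage is determined by a list of points from a union of at most [Z] sets of
    size at most [Z]; there are at most [Z] such lists, and only countably many stages. *)
Lemma closure_card {T I Z : Type} (e : nat) (A : I -> T -> Prop) (D : I -> Prop) :
  infinite_type Z -> almost_disjoint e A -> (forall i, card_le (elems (A i)) Z) ->
  card_le (elems D) Z -> card_le (elems (fun i => exists n, closure e A D n i)) Z.
Proof.
  intros HZ HA HAZ HD.
  assert (H : forall n, card_le (elems (closure e A D n)) Z).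
  { induction n as [|n IH]; auto.
    apply (card_le_or (closure e A D n)); auto.
    eapply card_le_trans; [now apply card_le_determined|].
    eapply card_le_trans; [apply card_le_elems|].
    eapply card_le_trans; [|apply infinite_list, HZ]. apply card_le_list.
    eapply card_le_trans; [|apply infinite_square, HZ].
    eapply card_le_trans; [apply (card_le_Union (Z := Z)
      (fun j : elems (closure e A D n) => A (proj1_sig j)));
      intros j; apply HAZ|].
    apply card_le_prod; [exact IH|apply card_le_refl]. }
  eapply card_le_trans; [apply (card_le_Union (closure e A D) H)|]. now apply infinite_prod_nat.
Qed.

(** Finitely many points are all covered by one stage [n], so [i] enters at stage [n + 1] at the
    latest. *)
Lemma closure_closed {T I : Type} (e : nat) (A : I -> T -> Prop) (D : I -> Prop)
    (l : list T) (i : I) :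
  NoDup l -> length l = e + 1 ->
  (forall x, In x l -> A i x /\ exists j n, closure e A D n j /\ A j x) ->
  exists n, closure e A D n i.
Proof.
  intros Hl He H.
  destruct (list_greatest lt (fun x n => exists j, closure e A D n j /\ A j x) l nat_strict_wo)
    as [x [n [_ [_ Hn]]]].
  { intros ->. simpl in He. lia. }
  { intros x Hx. destruct (H x Hx) as [_ [j [n Hj]]]. now exists n, j. }
  exists (S n). right. intros Hm.
  enough (length l <= e) by lia.
  apply (at_most_length e _ l Hm Hl). intros y Hy. split; [now apply H|].
  destruct (Hn y Hy) as [m [[j [Hj Aj]] Hmn]].
  assert (Hj' : closure e A D n j) by (apply (closure_le e A D m n); auto; lia).
  now exists (exist _ j Hj').
Qed.

(* Rank [i] by the first closed initial part containing it.  A set of rank [k] has at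
   most [e] points in common with the union of all sets of smaller rank, so the
   families of constant rank can be coloured one after the other. *)
Lemma extendable_succ {T I : Type} (Z L : Type) (c b e : nat) (A : I -> T -> Prop) :
  infinite_type Z -> is_succ_card Z L -> card_le I L ->
  (forall i, card_le (elems (A i)) Z) -> almost_disjoint e A ->
  (forall D : I -> Prop, card_le (elems D) Z ->
     extendable c (b + e) (fun i : elems D => A (proj1_sig i))) ->
  extendable c b A.
Proof.
  intros HZ [_ [_ HZL]] [u Hu] HAZ HA IH P f0 HP.
  destruct (initial_order L) as [RL [HRL HsL]].
  set (R := fun i j => RL (u i) (u j)).
  assert (HR : strict_wo R) by exact (strict_wo_pullback u Hu HRL).
  assert (Hs : forall i, card_le (seg R i) Z).
  { intros i. apply card_le_trans with (seg RL (u i)).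
    - exists (fun j => exist (fun k => RL k (u i)) (u (proj1_sig j)) (proj2_sig j)).
      intros j j' E. apply elems_eq, Hu. now injection E.
    - destruct (HZL (seg RL (u i)) (card_le_elems _)) as [H | H]; auto.
      exfalso. exact (HsL _ H). }
  set (D := fun k i => R i k \/ i = k).
  assert (HD : forall k, card_le (elems (D k)) Z).
  { intros k. apply card_le_or; [exact HZ|apply Hs|].
    eapply card_le_trans; [|exact HZ]. exists (fun _ => 0). intros [i Hi] [j Hj] _.
    apply elems_eq. simpl. congruence. }
  set (cl := fun k i => exists n, closure e A (D k) n i).
  assert (Hcl : forall k k', R k k' -> forall i, cl k i -> cl k' i).
  { intros k k' H i [n Hn]. exists n. revert i Hn. apply closure_sub.
    destruct HR as [_ [Tr _]]. intros i [Hi | ->]; left; eauto. }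
  (* [r i] is the rank of [i]. [N k] below is the union of the sets of rank [k], and [P' k] consists
     of the points decided before rank [k]. *)
  destruct (boolp.choice (P := fun i k => cl k i /\ forall k', R k' k -> ~ cl k' i)) as [r Hr].
  { intros i. apply (wf_min (proj1 HR) (fun k => cl k i)). exists i, 0. now right. }
  set (N := fun k x => exists i, r i = k /\ A i x).
  set (P' := fun k x => P x \/ exists k', R k' k /\ N k' x).
  assert (HP' : forall i, at_most (b + e) (fun x => A i x /\ P' (r i) x)).
  { intros i. apply at_most_sub with
      (fun x => (A i x /\ P x) \/ (A i x /\ exists k', R k' (r i) /\ N k' x)).
    2:{ unfold P'. tauto. }
    (* With [e + 1] points in sets of smaller rank, let [k] be the greatest of the ranks used. All
       these sets lie in [cl k], hence so does [i], against the minimality of [r i]. *)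
    apply at_most_or; auto. apply NNPP. intros Hm.
    destruct (not_at_most _ _ Hm) as [l [L1 [L2 L3]]].
    destruct (list_greatest R (fun x k => R k (r i) /\ N k x) l HR)
      as [x [k [_ [[Hk _] Hmax]]]].
    { intros ->. simpl in L2. lia. }
    { intros x Hx. apply L3, Hx. }
    apply (proj2 (Hr i) k Hk). apply (closure_closed e A (D k) l i L1 L2).
    intros y Hy. split; [now apply L3|].
    destruct (Hmax y Hy) as [k' [[_ [j [Ej Aj]]] Hk']]. exists j.
    assert (Hj : cl k j).
    { destruct (Hr j) as [Hj _]. rewrite Ej in Hj. destruct Hk' as [-> | Hk']; auto.
      now apply (Hcl k' k). }
    destruct Hj as [n Hn]. now exists n. }
  set (fst_rank := fun k x => N k x /\ forall k', R k' k -> ~ N k' x).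
  assert (Huniq : forall k k' x, fst_rank k x -> fst_rank k' x -> k = k').
  { intros k k' x [H1 H2] [H1' H2']. destruct (proj2 (proj2 HR) k k') as [? | [H | H]]; auto;
      exfalso; [exact (H2' _ H H1)|exact (H2 _ H H1')]. }
  (* [glue] lets each point outside [P] take its colour from the first rank covering it; points
     outside [P] and all sets stay uncoloured, which keeps new colours within the union. *)
  set (glue := fun (h : I -> T -> option nat) (F : T -> option nat) => forall x,
    (P x -> F x = f0 x) /\
    (~ P x -> forall k, fst_rank k x -> F x = h k x) /\
    (~ P x -> (forall k, ~ N k x) -> F x = None)).
  assert (Hglue : forall h, exists F, glue h F).
  { intros h. destruct (boolp.choice (P := fun x o => (P x -> o = f0 x) /\
      (~ P x -> forall k, fst_rank k x -> o = h k x) /\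
      (~ P x -> (forall k, ~ N k x) -> o = None))) as [F HF]; [|now exists F].
    intros x. destruct (classic (P x)) as [Px | Px]; [exists (f0 x); tauto|].
    destruct (classic (exists k, N k x)) as [E | E].
    - destruct (wf_min (proj1 HR) (fun k => N k x) E) as [k Hk].
      exists (h k x). split; [tauto|]. split.
      + intros _ k' Hk'. now rewrite (Huniq k k' x Hk Hk').
      + intros _ H. exfalso. exact (H k (proj1 Hk)).
    - exists None. split; [tauto|]. split; auto.
      intros _ k [Hk _]. exfalso. apply E. now exists k. }
  (* The recursion value at rank [k] is a whole colouring, obtained by extending the glued earlier
     ones from [P' k] to the sets of rank [k]. *)
  set (Q := fun k h f => exists F, glue h F /\
    (forall x, P' k x -> f x = F x) /\
    (forall x z, ~ P' k x -> f x = Some z -> z < c /\ exists i, A i x) /\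
    (forall i, r i = k -> exists z, z < c /\ exists! x, A i x /\ f x = Some z)).
  destruct (@wf_choice I _ R Q (fun _ => None) (proj1 HR)) as [g Hg].
  { intros k h. destruct (Hglue h) as [F HF].
    destruct (IH (fun i => r i = k)) with (P := P' k) (f0 := F) as [f [F1 [F2 F3]]].
    - apply card_le_trans with (elems (cl k)).
      + apply card_le_sub. intros i <-. apply Hr.
      + now apply closure_card.
    - intros [i Hi]. simpl. rewrite <- Hi. apply HP'.
    - exists f, F. split; auto. split; auto. split.
      + intros x z Px E. destruct (F2 x z Px E) as [Hz [i Ai]]. split; auto.
        now exists (proj1_sig i).
      + intros i Hi. exact (F3 (exist _ i Hi)). }
  destruct (Hglue g) as [f Hf].
  (* A point of [A i] is first covered at rank [r i] or earlier; in the latter case it lies in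
     [P' (r i)], so stage [r i] kept its colour. *)
  assert (Hfg : forall i x, A i x -> f x = g (r i) x).
  { intros i x Ax. destruct (Hg (r i)) as [h [Hh [F [HF [G1 _]]]]].
    destruct (Hf x) as [Hf1 [Hf2 _]]. destruct (HF x) as [HF1 [HF2 _]].
    destruct (classic (P x)) as [Px | Px].
    - rewrite Hf1, G1, HF1; auto. now left.
    - destruct (wf_min (proj1 HR) (fun k => N k x)) as [k Hk]; [now exists (r i), i|].
      rewrite (Hf2 Px k Hk).
      destruct (proj2 (proj2 HR) k (r i)) as [-> | [H | H]]; auto.
      + rewrite G1, (HF2 Px k Hk), (Hh k H); auto. right. exists k. split; auto. apply Hk.
      + exfalso. apply (proj2 Hk _ H). now exists i. }
  exists f. split; [|split].
  - intros x. apply Hf.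
  - intros x z Px E. destruct (Hf x) as [_ [Hf2 Hf3]].
    destruct (classic (exists k, N k x)) as [Ek | Nk].
    + destruct (wf_min (proj1 HR) (fun k => N k x) Ek) as [k Hk].
      destruct (Hg k) as [h [_ [F [_ [_ [G2 _]]]]]].
      apply (G2 x z).
      * intros [H | [k' [H1 H2]]]; [tauto|]. exact (proj2 Hk k' H1 H2).
      * rewrite <- (Hf2 Px k Hk). exact E.
    + rewrite Hf3 in E; auto; [discriminate|]. intros k Hk. apply Nk. now exists k.
  - intros i. destruct (Hg (r i)) as [h [_ [F [_ [_ [_ G3]]]]]].
    destruct (G3 i eq_refl) as [z [Hz [x [[Ax Ex] Hx]]]].
    exists z. split; auto. exists x. split.
    + split; auto. now rewrite (Hfg i x Ax).
    + intros y [Ay Ey]. apply Hx. split; auto. now rewrite <- (Hfg i y Ay).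
Qed.

(** * Induction on the number of successors and the bound *)

Lemma nth_succ_card_le (m : nat) (K L : Type) : nth_succ_card m K L -> card_le K L.
Proof.
  revert L. induction m as [|m IH]; simpl; intros L.
  - intros [f [Hf _]]. now exists f.
  - intros [Z [HZ [HL _]]]. apply card_le_trans with Z; auto.
Qed.

(** Going down one cardinal replaces [b] by [b + e] and [m + 1] by [m], which preserves
    [b + (m + 1) * e]. The induction is general in [b] and in the family, as both change. *)
Lemma extendable_nth_succ (m : nat) (K L : Type) (c b e : nat) (T I : Type) (A : I -> T -> Prop) :
  infinite_type K -> nth_succ_card m K L -> card_le I L ->
  (forall i, card_eq (elems (A i)) K) -> almost_disjoint e A ->
  b + (m + 1) * e + 1 < 2 * c -> extendable c b A.
Proof.
  intros HK. revert L b I A. induction m as [|m IH]; intros L b I A HL HI HA Had Hc.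
  - apply (extendable_base K c b e); auto; [|intros i; now apply card_eq_ge|lia].
    eapply card_le_trans; [exact HI|]. now apply card_eq_ge.
  - destruct HL as [Z [HZ HL]]. assert (HKZ := nth_succ_card_le m K Z HZ).
    apply (extendable_succ Z L c b e); auto.
    + now apply card_le_trans with K.
    + intros i. apply card_le_trans with K; auto. now apply card_eq_le.
    + intros D HD. apply (IH Z); auto; [|lia].
      intros i j Hij. apply Had. intros E. apply Hij. now apply elems_eq.
Qed.

(* w chi_CF(kappa^{+m}, kappa, d) <= bound: every (kappa^{+m},kappa,d)-system
   admits a weak CF colouring with cf_bound m d colours. *)
Theorem theorem5p1 (K L : Type) (m d : nat)
  (HK : infinite_type K) (HL : nth_succ_card m K L) (Hd : 0 < d) :
  forall (T I : Type) (A : I -> T -> Prop),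
    is_system L K d A ->
    exists f : T -> option nat, wcf_coloring A (cf_bound m d) f.
Proof.
  intros T I A [HI [_ [HA [_ Had]]]].
  destruct (extendable_nth_succ m K L (cf_bound m d) 0 (d - 1) T I A) with
    (P := fun _ : T => False) (f0 := fun _ : T => @None nat) as [f [_ [F1 F2]]]; auto.
  - now apply card_eq_le.
  - intros i j Hij. apply fewer_than_at_most; auto.
  (* With [b = 0] and [e = d - 1], the requirement is [n < 2 * (n / 2 + 1)] for
     [n = (m + 1) * (d - 1) + 1]. *)
  - unfold cf_bound. pose proof (Nat.div_mod_eq ((m + 1) * (d - 1) + 1) 2).
    pose proof (Nat.mod_upper_bound ((m + 1) * (d - 1) + 1) 2). lia.
  - intros i. exists nil. split; [apply Nat.le_refl|tauto].
  - exists f. split; [|split]; auto.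
    + intros x z E. now apply (F1 x).
    + intros x z E. now apply (F1 x z).
Qed.
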